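(* Let $X$ be a normal modal logic and let $I$ be an index set with $\omega\subseteq I$. Suppose that $X$ is complete with respect to a set of Kripke frames $F=\{(G_\alpha,R_\alpha):\alpha\in I\}$, where for every $\alpha\in I$, $G_\alpha$ is a nonempty infinite set and $R_\alpha$ is an accessibility relation (a binary relation) on $G_\alpha$. Let $H=\{(G_i^*,R_i^* ): i\in\omega\}$ be a set of Kripke frames such that for every $i\in\omega$: $$G_i^*=\{*,g_0,g_1,\dots,g_i\}\cup G_{\omega i},$$ where $G_{\omega i}=\{\eta_{ij}: j\in\omega\}$ has cardinality $\aleph_0$, $\{*,g_0,\dots,g_i\}\cap G_{\omega i}=\emptyset$, the elements $*,g_0,\dots,g_i$ are distinct, and $$R_i^*=\{( *,g_j):0\le j\le i\}\cup\{(g_j,g_k): 1\le j\le i,\ 1\le k\le i\}\cup\{(\eta,\eta):\eta\in G_{\omega i}\}.$$ If $H\subseteq F$, then $B$-translation is faithful with respect to $X$.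
   Context: The system $\mathbf{L_1}$ (Leśniewski's propositional ontology): fix a countably infinite set of name variables. The atomic formulas are exactly the expressions $\epsilon ab$ with $a,b$ name variables (possibly equal); formulas are built from atomic formulas by $\vee$ and $\neg$, the other connectives being the usual classical abbreviations. $\mathbf{L_1}$ is a Hilbert-style system of classical propositional logic (with modus ponens) over these formulas with the additional axiom schemata, for all name variables $a,b,c$: (Ax1) $\epsilon ab \supset \epsilon aa$; (Ax2) $(\epsilon ab \wedge \epsilon bc) \supset \epsilon ac$; (Ax3) $(\epsilon ab \wedge \epsilon bc) \supset \epsilon ba$. $B$-translation: to each name variable $a$ corresponds a propositional variable $p_a$, with distinct name variables corresponding to distinct propositional variables. $B$ maps formulas of $\mathbf{L_1}$ to propositional modal formulas by $B(\phi\vee\psi)=B(\phi)\vee B(\psi)$, $B(\neg\phi)=\neg B(\phi)$, $B(\epsilon ab)=p_a\wedge\Box(p_a\supset p_b)\wedge\bigl(p_b\supset\Box(p_b\supset p_a)\bigr)$. $B$-translation is faithful with respect to a modal logic $X$ if for every formula $\phi$ of $\mathbf{L_1}$, $\vdash_X B(\phi)$ implies $\vdash_{\mathbf{L_1}}\phi$. A normal modal logic is a set $X$ of propositional modal formulas with $\mathbf{K}\subseteq X$ that is closed under modus ponens, substitution and necessitation. $X$ is complete with respect to a set $F$ of Kripke frames if, for every modal formula $\chi$, $\vdash_X\chi$ holds if and only if $\chi$ is valid in every frame in $F$. *)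

(* Defs.v *)
From mathcomp Require Import all_boot.
From mathcomp Require Import boolp classical_sets functions cardinality.

Set Implicit Arguments.
Unset Strict Implicit.
Unset Printing Implicit Defensive.

Local Open Scope classical_set_scope.

(* The countably infinite sets of name variables and of propositional
   variables are both indexed by nat. *)
Definition name := nat.
Definition pvar := nat.

Inductive lform : Type :=
| Eps of name & name
| LOr of lform & lform
| LNot of lform.

Definition LImp (A B : lform) : lform := LOr (LNot A) B.
Definition LAnd (A B : lform) : lform := LNot (LOr (LNot A) (LNot B)).

(* The propositional basis is the Hilbert-Ackermann axiomatisation, whose
   primitive connectives are exactly disjunction and negation. *)
Inductive L1 : lform -> Prop :=
| L1_taut A : L1 (LImp (LOr A A) A)
| L1_add A B : L1 (LImp A (LOr A B))
| L1_perm A B : L1 (LImp (LOr A B) (LOr B A))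
| L1_sum A B C : L1 (LImp (LImp B C) (LImp (LOr A B) (LOr A C)))
| L1_ax1 a b : L1 (LImp (Eps a b) (Eps a a))
| L1_ax2 a b c : L1 (LImp (LAnd (Eps a b) (Eps b c)) (Eps a c))
| L1_ax3 a b c : L1 (LImp (LAnd (Eps a b) (Eps b c)) (Eps b a))
| L1_mp A B : L1 A -> L1 (LImp A B) -> L1 B.

Inductive mform : Type :=
| Var of pvar
| MOr of mform & mform
| MNot of mform
| Box of mform.

Definition MImp (A B : mform) : mform := MOr (MNot A) B.
Definition MAnd (A B : mform) : mform := MNot (MOr (MNot A) (MNot B)).

Fixpoint msubst (s : pvar -> mform) (A : mform) : mform :=
  match A with
  | Var p => s p
  | MOr B C => MOr (msubst s B) (msubst s C)
  | MNot B => MNot (msubst s B)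
  | Box B => Box (msubst s B)
  end.

Inductive logicK : mform -> Prop :=
| K_taut A : logicK (MImp (MOr A A) A)
| K_add A B : logicK (MImp A (MOr A B))
| K_perm A B : logicK (MImp (MOr A B) (MOr B A))
| K_sum A B C : logicK (MImp (MImp B C) (MImp (MOr A B) (MOr A C)))
| K_dist A B : logicK (MImp (Box (MImp A B)) (MImp (Box A) (Box B)))
| K_mp A B : logicK A -> logicK (MImp A B) -> logicK B
| K_nec A : logicK A -> logicK (Box A).

Definition normal_logic (X : set mform) : Prop :=
  [/\ logicK `<=` X,
      forall A B, X A -> X (MImp A B) -> X B,
      forall s A, X A -> X (msubst s A)
    & forall A, X A -> X (Box A)].

Record frame : Type := Frame {
  world :> Type;
  acc : world -> world -> Prop }.

Fixpoint sat (K : frame) (V : pvar -> set K) (w : K) (A : mform) : Prop :=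
  match A with
  | Var p => V p w
  | MOr B C => sat V w B \/ sat V w C
  | MNot B => ~ sat V w B
  | Box B => forall v : K, acc w v -> sat V v B
  end.

Definition valid (K : frame) (A : mform) : Prop :=
  forall (V : pvar -> set K) (w : K), sat V w A.

Definition complete_wrt (X : set mform) (F : set frame) : Prop :=
  forall A : mform, X A <-> (forall K : frame, F K -> valid K A).

Fixpoint Btrans (p : name -> pvar) (A : lform) : mform :=
  match A with
  | Eps a b =>
      MAnd (MAnd (Var (p a)) (Box (MImp (Var (p a)) (Var (p b)))))
           (MImp (Var (p b)) (Box (MImp (Var (p b)) (Var (p a)))))
  | LOr B C => MOr (Btrans p B) (Btrans p C)
  | LNot B => MNot (Btrans p B)
  end.

Definition B_faithful (p : name -> pvar) (X : set mform) : Prop :=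
  forall A : lform, X (Btrans p A) -> L1 A.

(* The set {g_0, ..., g_i} is [range g] and G_{omega i} is [range eta].  The
   relation links only those g_j of index at least 1 to one another, so g_0 is
   a dead end seen from the point [star]. *)
Definition star_frame (i : nat) (K : frame) : Prop :=
  exists (star : K) (g : 'I_i.+1 -> K) (eta : nat -> K),
    [/\ [set: K] = ([set star] `|` range g) `|` range eta,
        (range eta #= [set: nat])%card,
        ([set star] `|` range g) `&` range eta = set0,
        ~ range g star /\ injective g
      & forall u v : K, acc u v <->
          [\/ u = star /\ range g v,
              exists j k : 'I_i.+1,
                [/\ (1 <= j)%N, (1 <= k)%N, u = g j & v = g k]
            | range eta u /\ u = v]].

(* Main.v *)
Require Import Defs.
From mathcomp Require Import all_boot.
From mathcomp Require Import boolp classical_sets functions cardinality.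

(** If [phi] is not provable, there is a theory extending L1, not containing
    [phi], that decides every atom [Eps a b] whose names are below a bound [n]
    on the names of [phi].  In a frame where a world [w] sees exactly the points
    [g_j], [j < n], all different from [w], make [p_a] true at [w] iff the theory
    contains [Eps a a], and at [g_j] iff it contains [Eps j a].  By Ax1-Ax3 the
    formula [B(Eps a b)] then holds at [w] iff the theory contains [Eps a b]
    (the name [a] itself, as an index, is the witness for "only if"), so
    [B(phi)] fails at [w].  The point [*] of [H_n] is such a world. *)

Set Implicit Arguments.
Unset Strict Implicit.
Unset Printing Implicit Defensive.

Local Open Scope classical_set_scope.

(** * Theories over L1 and derived propositional rules *)

Definition L1_theory (T : set lform) : Prop :=
  L1 `<=` T /\ forall A B, T A -> T (LImp A B) -> T B.

Lemma L1_theory_L1 : L1_theory L1.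
Proof. by split=> // A B; apply: L1_mp. Qed.

Section Theory.
Variables (T : set lform) (T_theory : L1_theory T).

Lemma theory_L1 A : L1 A -> T A.
Proof. by case: T_theory => sub _ /sub. Qed.

Lemma theory_mp A B : T (LImp A B) -> T A -> T B.
Proof. by case: T_theory => _ mp AB /mp; apply. Qed.

Lemma theory_or_mono A B C : T (LImp B C) -> T (LImp (LOr A B) (LOr A C)).
Proof. exact/theory_mp/theory_L1/L1_sum. Qed.

Lemma theory_imp_trans A B C : T (LImp A B) -> T (LImp B C) -> T (LImp A C).
Proof. by move=> AB BC; apply: theory_mp AB; apply: theory_or_mono. Qed.

Lemma theory_or_perm A B : T (LOr A B) -> T (LOr B A).
Proof. exact/theory_mp/theory_L1/L1_perm. Qed.

Lemma theory_imp_orl A B : T (LImp A (LOr A B)).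
Proof. exact/theory_L1/L1_add. Qed.

Lemma theory_imp_orr A B : T (LImp B (LOr A B)).
Proof. exact: theory_imp_trans (theory_imp_orl B A) (theory_L1 (L1_perm _ _)). Qed.

Lemma theory_imp_refl A : T (LImp A A).
Proof. exact: theory_imp_trans (theory_imp_orl A A) (theory_L1 (L1_taut A)). Qed.

Lemma theory_or_elim A B C :
  T (LImp A C) -> T (LImp B C) -> T (LImp (LOr A B) C).
Proof.
move=> AC BC; apply: theory_imp_trans (theory_or_mono A BC) _.
apply: theory_imp_trans (theory_L1 (L1_perm A C)) _.
exact: theory_imp_trans (theory_or_mono C AC) (theory_L1 (L1_taut C)).
Qed.

Lemma theory_weaken A B : T B -> T (LImp A B).
Proof. exact/theory_mp/theory_imp_orr. Qed.

Lemma theory_imp_mp A B C : T (LImp A (LImp B C)) -> T (LImp A B) -> T (LImp A C).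
Proof.
(* With the premises exchanged, transitivity yields [LImp A (LImp A C)], which is then
   contracted. *)
move=> ABC AB; have BAC : T (LImp B (LImp A C)).
  apply: theory_mp ABC; apply: theory_or_elim.
    exact: theory_imp_trans (theory_imp_orl _ C) (theory_imp_orr _ _).
  exact/theory_or_mono/theory_imp_orr.
apply: theory_mp (theory_imp_trans AB BAC).
exact: theory_or_elim (theory_imp_orl _ _) (theory_imp_refl _).
Qed.

Lemma theory_cases A B : T (LImp A B) -> T (LImp (LNot A) B) -> T B.
Proof.
(* [LImp A A] unfolds to the excluded middle [LOr (LNot A) A]. *)
move=> AB nAB; apply: theory_mp (theory_imp_refl A).
exact: theory_or_elim.
Qed.

Lemma theory_not_not A : T A -> T (LNot (LNot A)).
Proof. exact/theory_mp/theory_or_perm/theory_imp_refl. Qed.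

Lemma theory_not_or A B : T (LNot A) -> T (LNot B) -> T (LNot (LOr A B)).
Proof.
(* By idempotence it suffices that [LOr A B] implies its own negation; each disjunct does so, being
   refuted. *)
move=> nA nB; apply: theory_mp (theory_L1 (L1_taut _)) _.
apply: theory_or_elim; [move: nA | move: nB]; exact/theory_mp/theory_imp_orl.
Qed.

Lemma theory_and A B : T A -> T B -> T (LAnd A B).
Proof. by move=> /theory_not_not nA /theory_not_not nB; apply: theory_not_or. Qed.

Lemma theory_Eps_refl a b : T (Eps a b) -> T (Eps a a).
Proof. exact/theory_mp/theory_L1/L1_ax1. Qed.

Lemma theory_Eps_trans a b c : T (Eps a b) -> T (Eps b c) -> T (Eps a c).
Proof. by move=> ab /(theory_and ab); exact/theory_mp/theory_L1/L1_ax2. Qed.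

Lemma theory_Eps_sym a b c : T (Eps a b) -> T (Eps b c) -> T (Eps b a).
Proof. by move=> ab /(theory_and ab); exact/theory_mp/theory_L1/L1_ax3. Qed.

(** The deduction theorem in semantic dress: this set plays the part of the theory generated by [T]
    and [A]. *)
Lemma theory_adjoin A : L1_theory [set B | T (LImp A B)].
Proof.
split=> [B /theory_L1 TB | B C AB ABC]; first exact: theory_weaken.
exact: theory_imp_mp ABC AB.
Qed.

End Theory.

(** * Theories that decide finitely many formulas *)

Definition decides (T : set lform) (A : lform) : Prop := T A \/ T (LNot A).

Lemma decides_sub (T T' : set lform) A : T `<=` T' -> decides T A -> decides T' A.
Proof. by move=> sub [] /sub; [left | right]. Qed.

(** Lindenbaum's construction along a finite list: if adjoining [A] and adjoining [LNot A] both gave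
    [phi], then [T] would contain [phi] by cases. Later extensions keep what is already decided. *)
Lemma L1_theory_deciding (phi : lform) (s : seq lform) : ~ L1 phi ->
  exists T, [/\ L1_theory T, ~ T phi & foldr (fun A => and (decides T A)) True s].
Proof.
move=> nphi; elim: s => [|A s [T [thT nTphi decT]]].
  by exists L1; split=> //; apply: L1_theory_L1.
have adjoin C : ~ T (LImp C phi) -> C = A \/ C = LNot A ->
    exists T', [/\ L1_theory T', ~ T' phi
                 & foldr (fun A => and (decides T' A)) True (A :: s)].
  move=> nCphi CA; exists [set B | T (LImp C B)].
  split=> //=; first exact: theory_adjoin.
  split.
    by case: CA => ->; [left | right]; apply: theory_imp_refl.
  elim: s decT => //= B s IHs [decB /IHs decs]; split=> //.
  by apply: decides_sub decB => D; apply: theory_weaken.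
have [Aphi | nAphi] := pselect (T (LImp A phi)); last by apply: adjoin nAphi _; left.
apply: (adjoin (LNot A)); last by right.
by move=> /(theory_cases thT Aphi).
Qed.

Fixpoint names_below (n : nat) (A : lform) : Prop :=
  match A with
  | Eps a b => (a < n)%N /\ (b < n)%N
  | LOr B C => names_below n B /\ names_below n C
  | LNot B => names_below n B
  end.

Lemma names_below_leq m n A : (m <= n)%N -> names_below m A -> names_below n A.
Proof.
move=> mn; elim: A => [a b [am bm] | B IHB C IHC [/IHB ? /IHC ?] | B IHB] //=.
by split; apply: leq_trans mn.
Qed.

Lemma names_below_exists A : exists n, names_below n A.
Proof.
elim: A => [a b | B [m Bm] C [n Cn] | B [n Bn]]; last by exists n.
  by exists (maxn a b).+1; split; rewrite ltnS ?leq_maxl ?leq_maxr.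
exists (maxn m n); split; first exact: names_below_leq (leq_maxl m n) Bm.
exact: names_below_leq (leq_maxr m n) Cn.
Qed.

Lemma L1_theory_deciding_Eps (phi : lform) (n : nat) : ~ L1 phi ->
  exists T, [/\ L1_theory T, ~ T phi
    & forall a b, (a < n)%N -> (b < n)%N -> decides T (Eps a b)].
Proof.
pose ab := [seq (a, b) | a <- iota 0 n, b <- iota 0 n].
move=> /(L1_theory_deciding [seq Eps x.1 x.2 | x <- ab]) [T [thT nT decT]].
exists T; split=> // a b an bn; have : (a, b) \in ab.
  by apply/allpairsP; exists (a, b); rewrite !mem_iota.
elim: ab decT => //= x s IHs [decx decs]; rewrite inE => /orP[/eqP abx|].
  by move: decx; rewrite -abx.
exact: IHs.
Qed.

(** * Satisfaction of translated formulas *)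

Lemma sat_MImp (K : frame) (V : pvar -> set K) w A B :
  sat V w (MImp A B) <-> (sat V w A -> sat V w B).
Proof.
split=> /= [[]// | AB].
by have [/AB|] := pselect (sat V w A); [right | left].
Qed.

Lemma sat_Box (K : frame) (V : pvar -> set K) w A :
  sat V w (Box A) <-> forall v, acc w v -> sat V v A.
Proof. by []. Qed.

Lemma sat_MAnd (K : frame) (V : pvar -> set K) w A B :
  sat V w (MAnd A B) <-> sat V w A /\ sat V w B.
Proof.
split=> /= [nAB | [sA sB] []//].
by split; apply: contrapT => ns; apply: nAB; [left | right].
Qed.

Lemma sat_Btrans_Eps (K : frame) (V : pvar -> set K) w (p : name -> pvar) a b :
  sat V w (Btrans p (Eps a b)) <->
  [/\ V (p a) w, forall v, acc w v -> V (p a) v -> V (p b) v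
    & V (p b) w -> forall v, acc w v -> V (p b) v -> V (p a) v].
Proof.
rewrite [Btrans p _]/= !sat_MAnd sat_MImp.
have box x y : sat V w (Box (MImp (Var x) (Var y))) <->
    forall v, acc w v -> V x v -> V y v.
  rewrite sat_Box.
  split=> xy v wv; have [to_imp of_imp] := sat_MImp V v (Var x) (Var y).
    exact: to_imp (xy v wv).
  exact: of_imp (xy v wv).
by rewrite !box; split=> [[[]]|[]].
Qed.

(** * The valuation read off from a deciding theory *)

Section Countermodel.
Variables (p : name -> pvar) (p_inj : injective p).
Variables (K : frame) (w : K) (n : nat) (g : 'I_n -> K) (g_inj : injective g).
Hypotheses (g_neq_w : ~ range g w) (acc_w : forall v, acc w v <-> range g v).
Variables (T : set lform) (T_theory : L1_theory T).
Hypothesis T_dec : forall a b, (a < n)%N -> (b < n)%N -> decides T (Eps a b).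

(** The index [j] of a point is reused as a name. Variables outside the image of [p] are false
    everywhere. *)
Definition countermodel (q : pvar) (v : K) : Prop :=
  exists2 a, q = p a &
    (v = w /\ T (Eps a a)) \/ (exists2 j : 'I_n, v = g j & T (Eps j a)).

Lemma countermodel_root a : countermodel (p a) w = T (Eps a a).
Proof.
apply/propext; split=> [[_ /p_inj <- [[]//|[j wj]]] | Taa]; last by exists a => //; left.
by case: g_neq_w; exists j.
Qed.

Lemma countermodel_leaf a j : countermodel (p a) (g j) = T (Eps j a).
Proof.
apply/propext; split=> [[_ /p_inj <- [[gw _]|[k /g_inj ->]//]] | Tja].
  by case: g_neq_w; exists j.
by exists a => //; right; exists j.
Qed.

Lemma countermodel_Eps a b : (a < n)%N -> (b < n)%N ->
  sat countermodel w (Btrans p (Eps a b)) <-> T (Eps a b).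
Proof.
move=> an bn; rewrite sat_Btrans_Eps !countermodel_root; split=> [[Taa ab _] | Tab].
  have := ab (g (Ordinal an)); rewrite !countermodel_leaf; apply=> //.
  by apply/acc_w; exists (Ordinal an).
split; first exact: theory_Eps_refl Tab.
- move=> v /acc_w[j _ <-]; rewrite !countermodel_leaf => Tja.
  exact: theory_Eps_trans Tja Tab.
(* The truth of [p b] at [w] supplies [Eps b b], so that Ax3 turns [Eps a b] into [Eps b a]; Ax2
   then leads from [Eps j b] to [Eps j a]. *)
- move=> Tbb v /acc_w[j _ <-]; rewrite !countermodel_leaf => Tjb.
  exact: theory_Eps_trans Tjb (theory_Eps_sym T_theory Tab Tbb).
Qed.

(** The two halves need a joint induction, since [LNot] exchanges them. Passing from the model to
    [T] is enough to refute a formula that [T] omits. *)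
Lemma countermodel_truth A : names_below n A ->
  (sat countermodel w (Btrans p A) -> T A) /\
  (~ sat countermodel w (Btrans p A) -> T (LNot A)).
Proof.
elim: A => [a b [an bn] | B IHB C IHC [/IHB[TB TnB] /IHC[TC TnC]] | B IHB /IHB[TB TnB]].
- rewrite countermodel_Eps //; split=> // nTab.
  by case: (T_dec an bn).
- split=> /= [[/TB|/TC] | nBC].
  + exact/(theory_mp T_theory)/(theory_imp_orl T_theory).
  + exact/(theory_mp T_theory)/(theory_imp_orr T_theory).
  + by apply: theory_not_or => //; [apply: TnB | apply: TnC] => ?; apply: nBC; [left | right].
- by split=> //= /contrapT /TB; apply: theory_not_not.
Qed.

End Countermodel.

(** * Refutation in the star frames *)

Lemma Btrans_refutable (p : name -> pvar) (K : frame) (w : K) (n : nat)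
    (g : 'I_n -> K) (phi : lform) :
  injective p -> injective g -> ~ range g w ->
  (forall v, acc w v <-> range g v) -> names_below n phi ->
  valid K (Btrans p phi) -> L1 phi.
Proof.
move=> p_inj g_inj gw acc_w phin valphi; apply: contrapT.
move=> /(L1_theory_deciding_Eps n)[T [thT nT decT]]; apply: nT.
have [truth _] := countermodel_truth p_inj g_inj gw acc_w thT decT phin.
exact/truth/valphi.
Qed.

(** The root is the point [*]: it is neither some [g_j] nor some [eta_j], so only the first clause
    of the relation gives it successors. *)
Lemma star_frame_root i K : star_frame i K ->
  exists (w : K) (g : 'I_i.+1 -> K),
    [/\ injective g, ~ range g w & forall v, acc w v <-> range g v].
Proof.
move=> [w [g [eta [_ _ disj [gw g_inj] accE]]]]; exists w, g; split=> // v.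
rewrite accE; split=> [[[]//|[j [k [_ _ wj _]]]|[etaw _]] | gv]; last by apply: Or31.
  by case: gw; exists j.
have : (([set w] `|` range g) `&` range eta) w by split=> //; left.
by rewrite disj.
Qed.

Theorem theorem7p3 (p : name -> pvar) (p_inj : injective p)
  (X : set mform) (X_normal : normal_logic X)
  (I : Type) (omega : nat -> I) (omega_inj : injective omega)
  (F : I -> frame)
  (F_nonempty : forall alpha : I, [set: F alpha] !=set0)
  (F_infinite : forall alpha : I, infinite_set [set: F alpha])
  (X_complete : complete_wrt X (range F))
  (H : nat -> frame) (H_star : forall i : nat, star_frame i (H i))
  (H_sub_F : range H `<=` range F) :
  B_faithful p X.
Proof.
move=> phi /X_complete F_valid; have [n phin] := names_below_exists phi.
have [w [g [g_inj gw acc_w]]] := star_frame_root (H_star n).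
apply: (Btrans_refutable p_inj g_inj gw acc_w).
  (* [H n] has the [n.+1] points [g_0], ..., [g_n], so the bound [n] on the names is relaxed by
     one. *)
  exact: names_below_leq (leqnSn n) phin.
by apply/F_valid/H_sub_F; exists n.
Qed.
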